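(* Let $p$ be a prime, $m$ a positive integer, $q=p^m$ with $q>2$, and $n=q^2+1$. Let $\lambda\in\mathbb{F}_{q^2}^*$ have multiplicative order $r$, where $r\mid(q-1)$ and $\nu_2(r)=\nu_2(q-1)$. Let $\delta\in\mathbb{F}_{q^4}$ be a primitive $rn$-th root of unity with $\delta^n=\lambda$, let $g_1(x)=(x-\delta)(x-\delta^{q^2})$, $g_{q^2-q+1}(x)=(x-\delta^{q^2-q+1})(x-\delta^{q^4-q^3+q^2})$, and let $\mathcal{C}(1,q^2-q+1)$ be the $\lambda$-constacyclic code of length $n$ over $\mathbb{F}_{q^2}$ with check polynomial $g_1(x)g_{q^2-q+1}(x)$. Then the subfield subcode $\mathcal{C}(1,q^2-q+1)|_{\mathbb{F}_q}=\mathcal{C}(1,q^2-q+1)\cap\mathbb{F}_q^n$ has parameters $[q^2+1,4,q^2-q]$ and weight enumerator \[ 1+(q^2-q)(q^2+1)z^{q^2-q}+(q-1)(q^2+1)z^{q^2}, \] and its dual code (over $\mathbb{F}_q$) has parameters $[q^2+1,q^2-3,4]$.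
   Context: $\nu_2$ is the $2$-adic valuation. A $\lambda$-constacyclic code of length $n$ over $\mathbb{F}_{q^2}$ is an ideal of $\mathbb{F}_{q^2}[x]/\langle x^n-\lambda\rangle$; its check polynomial is $(x^n-\lambda)/g(x)$ where $g$ is the monic generator polynomial. The weight enumerator is $\sum_iA_iz^i$ with $A_i$ the number of codewords of Hamming weight $i$. *)

(* Defs.v *)
From HB Require Import structures.
From mathcomp Require Import all_boot all_order all_algebra all_field.
Set Implicit Arguments. Unset Strict Implicit. Unset Printing Implicit Defensive.
Import GRing.Theory.
Local Open Scope ring_scope.

(* Everything lives inside a finite field L = F_{q^4}; the subfields
   F_{q^2} and F_q are the fixed points of the Frobenius powers. *)

Definition in_subfield (L : finFieldType) (k : nat) (x : L) : bool :=
  x ^+ k == x.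

Definition hweight (L : finFieldType) (n : nat) (c : 'rV[L]_n) : nat :=
  #|[set i : 'I_n | c 0 i != 0]|.

Definition word_poly (L : finFieldType) (n : nat) (c : 'rV[L]_n) : {poly L} :=
  \sum_(i < n) c 0 i *: 'X^i.

(* The lambda-constacyclic code of length n over the subfield F_{k}
   (k = q^2) with check polynomial h: the ideal of F_k[x]/<x^n - lam>
   generated by g = (x^n - lam)/h, i.e. the words over F_k whose
   polynomial is divisible by g. *)
Definition constacyclic_code (L : finFieldType) (k n : nat) (lam : L)
    (h : {poly L}) : {set 'rV[L]_n} :=
  [set c : 'rV[L]_n | [forall i, in_subfield k (c 0 i)] &&
     ((('X^n - lam%:P) %/ h) %| word_poly c)].

Definition subfield_subcode (L : finFieldType) (q n : nat)
    (C : {set 'rV[L]_n}) : {set 'rV[L]_n} :=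
  [set c in C | [forall i, in_subfield q (c 0 i)]].

Definition dual_code (L : finFieldType) (q n : nat)
    (D : {set 'rV[L]_n}) : {set 'rV[L]_n} :=
  [set y : 'rV[L]_n | [forall i, in_subfield q (y 0 i)] &&
     [forall c in D, \sum_(i < n) c 0 i * y 0 i == 0]].

Definition wt_count (L : finFieldType) (n : nat) (D : {set 'rV[L]_n}) (i : nat) : nat :=
  #|[set c in D | hweight c == i]|.

Definition min_dist_is (L : finFieldType) (n : nat) (D : {set 'rV[L]_n}) (d : nat) : Prop :=
  (exists2 c, c \in D & (c != 0) && (hweight c == d)) /\
  (forall c, c \in D -> c != 0 -> (d <= hweight c)%N).

(* Main.v *)
Require Import Defs.
From HB Require Import structures.
From mathcomp Require Import all_boot all_order all_algebra all_field.
From mathcomp Require Import cyclic zify ring.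
Set Implicit Arguments. Unset Strict Implicit. Unset Printing Implicit Defensive.
Import GRing.Theory.
Local Open Scope ring_scope.

(* Write fr x = x^q and N2 x = x^(q^2+1), the norm from F_{q^4} to F_{q^2}.  The roots of the
   check polynomial are the four conjugates fr^j delta, so the subfield subcode consists
   of the words (Tr (a delta^-i))_{i < q^2+1}, with Tr the trace from F_{q^4} to F_q.  The
   powers delta^-i represent, up to F_q^*, the points of the elliptic quadric
   {x | N2 x in F_q} of PG(3,q).  Stereographic projection shows that a plane meeting
   the quadric does so in 1 or q+1 points, and the planes meeting it in one point are
   the q^2+1 tangent planes; this is the weight enumerator.  Dually, a word in the
   dual code is a linear relation between the points: no three points are collinear,
   and four points in a common plane are dependent. *)

(** The multiplicative group of a finite field is cyclic, so a suitable power of a generator is a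
    primitive [k]-th root of unity, and its powers are all the solutions. *)
Lemma card_unity_roots (L : finFieldType) (k : nat) :
  (0 < k)%N -> (k %| #|L|.-1)%N -> #|[set x : L | x ^+ k == 1]| = k.
Proof.
move=> k_gt0 k_dvd.
have cL1 : (1 < #|L|)%N := finNzRing_gt1 L.
have N_gt0 : (0 < #|L|.-1)%N by lia.
have [w wP] : exists w : L, (#|L|.-1).-primitive_root w.
  have /hasP[w _ wP] : has (#|L|.-1).-primitive_root (enum [pred x : L | x != 0]).
    apply: has_prim_root => //.
    - apply/allP => x; rewrite mem_enum inE unity_rootE => x0.
      apply/eqP/(mulfI x0); rewrite mulr1 -exprS prednK ?expf_card //; lia.
    - exact: enum_uniq.
    - by rewrite -cardE -(cardC1 (0 : L)); apply: subset_leq_card; apply/subsetP.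
  by exists w.
have zP := dvdn_prim_root wP k_dvd.
set z := w ^+ _ in zP.
suff -> : [set x : L | x ^+ k == 1] = [set z ^+ (i : 'I_k) | i in 'I_k].
  rewrite card_in_imset ?card_ord // => i j _ _ /eqP.
  by rewrite (eq_prim_root_expr zP) !modn_small // => /eqP/val_inj.
apply/setP => x; rewrite inE; apply/eqP/imsetP => [/(prim_rootP zP)[i ->]|[i _ ->]].
  by exists i.
by rewrite exprAC (prim_expr_order zP) expr1n.
Qed.

Lemma word_polyE (L : finFieldType) (n : nat) (c : 'rV[L]_n) :
  word_poly c = rVpoly c.
Proof.
rewrite /word_poly /rVpoly poly_def; apply: eq_bigr => i _.
by rewrite valK.
Qed.

Lemma hweight0 (L : finFieldType) (n : nat) : hweight (0 : 'rV[L]_n) = 0%N.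
Proof. by apply/eqP; rewrite cards_eq0; apply/eqP/setP => j; rewrite !inE mxE eqxx. Qed.

(** * The elliptic quadric *)

Section Ovoid.

Variables (L : finFieldType) (q : nat).
Hypothesis q_gt1 : (1 < q)%N.
Hypothesis cardL : #|L| = (q ^ 4)%N.
Hypothesis frD : forall x y : L, (x + y) ^+ q = x ^+ q + y ^+ q.

(** * The Frobenius map and its fixed field *)

Definition fr (x : L) := x ^+ q.

Lemma fr_add x y : fr (x + y) = fr x + fr y. Proof. exact: frD. Qed.
Lemma fr_mul x y : fr (x * y) = fr x * fr y. Proof. exact: exprMn. Qed.
Lemma fr0 : fr 0 = 0. Proof. by rewrite /fr expr0n; case: q q_gt1. Qed.
Lemma fr1 : fr 1 = 1. Proof. exact: expr1n. Qed.
Lemma fr_opp x : fr (- x) = - fr x.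
Proof. by apply/eqP; rewrite -addr_eq0 -fr_add addNr fr0. Qed.
Lemma fr_sub x y : fr (x - y) = fr x - fr y.
Proof. by rewrite fr_add fr_opp. Qed.
Lemma fr_inv x : fr x^-1 = (fr x)^-1. Proof. exact: exprVn. Qed.
Lemma fr_exp x k : fr (x ^+ k) = fr x ^+ k. Proof. exact: exprAC. Qed.
Lemma fr_sum (I : Type) (s : seq I) (P : pred I) (F : I -> L) :
  fr (\sum_(i <- s | P i) F i) = \sum_(i <- s | P i) fr (F i).
Proof. exact: (big_morph fr fr_add fr0). Qed.
Lemma fr4 x : fr (fr (fr (fr x))) = x.
Proof.
by rewrite /fr -!exprM -[RHS]expf_card cardL !expnS expn0 muln1 !mulnA.
Qed.
Lemma fr_inj : injective fr.
Proof. by move=> x y e; rewrite -(fr4 x) e fr4. Qed.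
Lemma fr_eq0 x : (fr x == 0) = (x == 0).
Proof. by rewrite -(inj_eq fr_inj) fr0. Qed.

Definition frE := (fr_add, fr_mul, fr_opp, fr0, fr1, fr4).

(** Locked, so that [inE] does not unfold membership in the subfield. *)
Definition Fq : {set L} := locked [set x | fr x == x].
Definition Tr x := x + fr x + fr (fr x) + fr (fr (fr x)).
Definition T2 x := x + fr (fr x).
Definition N2 x := x * fr (fr x).

Lemma FqP x : reflect (fr x = x) (x \in Fq).
Proof. by rewrite /Fq -lock inE; exact: eqP. Qed.
Lemma Fq0 : 0 \in Fq. Proof. by apply/FqP; rewrite fr0. Qed.
Lemma Fq1 : 1 \in Fq. Proof. by apply/FqP; rewrite fr1. Qed.
Lemma FqD x y : x \in Fq -> y \in Fq -> x + y \in Fq.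
Proof. by move=> /FqP hx /FqP hy; apply/FqP; rewrite fr_add hx hy. Qed.
Lemma FqN x : x \in Fq -> - x \in Fq.
Proof. by move=> /FqP hx; apply/FqP; rewrite fr_opp hx. Qed.
Lemma FqB x y : x \in Fq -> y \in Fq -> x - y \in Fq.
Proof. by move=> hx hy; apply: FqD => //; exact: FqN. Qed.
Lemma FqM x y : x \in Fq -> y \in Fq -> x * y \in Fq.
Proof. by move=> /FqP hx /FqP hy; apply/FqP; rewrite fr_mul hx hy. Qed.
Lemma FqV x : x \in Fq -> x^-1 \in Fq.
Proof. by move=> /FqP hx; apply/FqP; rewrite fr_inv hx. Qed.

Lemma predq4 : (q ^ 4).-1 = (q.-1 * (q.+1 * (q ^ 2).+1))%N.
Proof.
case: q q_gt1 => // k _.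
have -> : (k.+1 ^ 4 = (k * (k.+2 * (k.+1 ^ 2).+1)).+1)%N by ring.
by [].
Qed.

Lemma Fq_unitP x : reflect (x != 0 /\ x \in Fq) (x ^+ q.-1 == 1).
Proof.
have qE : q = q.-1.+1 by rewrite prednK // ltnW.
apply: (iffP eqP) => [h|[x0 /FqP]].
  split; last by apply/FqP; rewrite /fr qE exprS h mulr1.
  apply: contra_eq_neq h => ->.
  by rewrite expr0n -subn1 subn_eq0 leqNgt q_gt1 eq_sym oner_neq0.
by rewrite /fr {1}qE exprS => h; apply: (mulfI x0); rewrite h mulr1.
Qed.

Lemma card_Fq_unit : #|[set x in Fq | x != 0]| = q.-1.
Proof.
rewrite -[RHS](card_unity_roots (L := L)); first last.
- by rewrite cardL predq4 dvdn_mulr.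
- by rewrite -subn1 subn_gt0.
by apply: eq_card => x; rewrite [LHS]inE [RHS]inE andbC; apply/andP/Fq_unitP.
Qed.

Lemma card_Fq : #|Fq| = q.
Proof.
rewrite (cardsD1 0) Fq0 add1n -[RHS](prednK (ltnW q_gt1)) -card_Fq_unit.
by congr _.+1; apply: eq_card => x; rewrite !inE andbC.
Qed.

(** [A] is a union of affine lines in direction [v], and [K] picks one point on each. No linearity
    of [K] is asked for, so this serves both for hyperplanes and for stereographic projection. *)
Lemma card_transversal (A K : {set L}) (v : L) :
  v != 0 -> K \subset A ->
  (forall x t, x \in A -> t \in Fq -> x + t * v \in A) ->
  (forall x, x \in A -> exists2 t, t \in Fq & x + t * v \in K) ->
  (forall x t, x \in K -> t \in Fq -> x + t * v \in K -> t = 0) ->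
  #|A| = (#|K| * q)%N.
Proof.
move=> v0 KA Acl Aex Kuniq; rewrite -card_Fq -cardsX.
rewrite -(card_in_imset (f := fun u : L * L => u.1 + u.2 * v) (D := setX K Fq)).
  apply: eq_card => x; apply/idP/imsetP => [xA|[[y t] /= /setXP[yK tF] ->]]; last first.
    exact: Acl (subsetP KA y yK) tF.
  have [t tF xK] := Aex x xA.
  exists (x + t * v, - t); first by apply/setXP; split=> //; exact: FqN.
  by rewrite /= mulNr addrK.
move=> [x t] [y s] /setXP[/= xK tF] /setXP[/= yK sF] e.
have yE : y = x + (t - s) * v by rewrite mulrBl addrA e addrK.
have /eqP : t - s = 0.
  by apply: (Kuniq x) => //; [exact: FqB|rewrite -yE].
by rewrite subr_eq0 => /eqP ts; rewrite yE ts subrr mul0r addr0.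
Qed.

(** * The trace form and its hyperplanes *)

Lemma TrD x y : Tr (x + y) = Tr x + Tr y.
Proof. by rewrite /Tr !frE; ring. Qed.
Lemma Tr0 : Tr 0 = 0.
Proof. by rewrite /Tr !fr0 !addr0. Qed.
Lemma TrN x : Tr (- x) = - Tr x.
Proof. by rewrite /Tr !frE; ring. Qed.
Lemma TrZ t x : t \in Fq -> Tr (t * x) = t * Tr x.
Proof. by move=> /FqP ht; rewrite /Tr !fr_mul !ht; ring. Qed.
Lemma Tr_Fq x : Tr x \in Fq.
Proof. by apply/FqP; rewrite /Tr !frE; ring. Qed.
Lemma Tr_sum (I : Type) (s : seq I) (P : pred I) (F : I -> L) :
  Tr (\sum_(i <- s | P i) F i) = \sum_(i <- s | P i) Tr (F i).
Proof. exact: (big_morph Tr TrD Tr0). Qed.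

Lemma Tr_onto a : a != 0 -> exists v, Tr (a * v) = 1.
Proof.
move=> a0.
have [x Tx0] : exists x, Tr x != 0.
  apply/existsP; rewrite -[X in is_true X]negbK negb_exists; apply/negP => /forallP allT.
  (* The trace as a polynomial: its degree [q ^ 3] is too small for all [q ^ 4] elements to be
     roots. *)
  pose P : {poly L} := 'X^(q ^ 3) + ('X^(q ^ 2) + 'X^q + 'X).
  have lt1 : (q < q ^ 2)%N by rewrite -{1}(expn1 q) ltn_exp2l.
  have lt2 : (q ^ 2 < q ^ 3)%N by rewrite ltn_exp2l.
  have szP : size P = (q ^ 3).+1.
    rewrite /P size_polyDl size_polyXn // (leq_ltn_trans (size_polyD _ _)) //.
    rewrite gtn_max size_polyX (leq_ltn_trans (size_polyD _ _)) ?gtn_max ?size_polyXn ?ltnS.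
      by rewrite (leq_trans q_gt1) // (leq_trans (ltnW lt1)) // ltnW.
    by rewrite lt2 (ltn_trans lt1).
  have P0 : P != 0 by rewrite -size_poly_eq0 szP.
  have rootP : all (root P) (enum L).
    apply/allP => x _; rewrite rootE /P !hornerD !hornerXn hornerX.
    have := allT x; rewrite negbK /Tr /fr -!exprM => /eqP <-.
    apply/eqP; rewrite !expnS expn0 muln1 ?mulnA; ring.
  have := max_poly_roots P0 rootP (enum_uniq L).
  by rewrite -cardE szP cardL ltnS leq_exp2l.
exists (a^-1 * ((Tr x)^-1 * x)); rewrite mulVKf // TrZ ?mulVf //.
exact/FqV/Tr_Fq.
Qed.

Lemma Tr_nondeg a : (forall v, Tr (a * v) = 0) -> a = 0.
Proof.
move=> h; apply: contraTeq isT => /Tr_onto[v]; rewrite h => /esym/eqP.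
by rewrite oner_eq0.
Qed.

Lemma card_hyperplane a : a != 0 -> #|[set v | Tr (a * v) == 0]| = (q ^ 3)%N.
Proof.
move=> a0; have [v vE] := Tr_onto a0.
have := @card_transversal setT [set v | Tr (a * v) == 0] v.
rewrite cardsT cardL [(q ^ 4)%N]expnSr => /(_ _ _ _ _ _)/eqP.
rewrite eqn_pmul2r ?(ltnW q_gt1) // => h; apply/esym/eqP/h => //.
- by apply/eqP => v0; move: vE; rewrite v0 mulr0 Tr0 => /esym/eqP; rewrite oner_eq0.
- by move=> x t; rewrite !inE.
- move=> x _; exists (- Tr (a * x)); first exact/FqN/Tr_Fq.
  by rewrite inE mulrDr TrD mulrCA (TrZ _ (FqN (Tr_Fq _))) vE mulr1 subrr.
- move=> x t; rewrite !inE => /eqP xE tF; rewrite mulrDr TrD mulrCA (TrZ _ tF) xE vE.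
  by rewrite add0r mulr1 => /eqP.
Qed.

(** A vector [v] with [Tr (a * v) = 0] and [Tr (b * v) = 1] exists by independence; translating
    along it cuts the first hyperplane into [q] copies of the intersection. *)
Lemma card_hyperplaneI a b : a != 0 -> (forall t, t \in Fq -> b != t * a) ->
  #|[set v | (Tr (a * v) == 0) && (Tr (b * v) == 0)]| = (q ^ 2)%N.
Proof.
move=> a0 bna; have [u uE] := Tr_onto a0.
(* With this [c], removing from [v0] its component along [u] kills [Tr (a * _)] and turns
   [Tr (b * _)] into [Tr ((b - c * a) * v0) = 1]. *)
pose c := Tr (b * u).
have /Tr_onto[v0 v0E] : b - c * a != 0 by rewrite subr_eq0 bna ?Tr_Fq.
pose v := v0 - Tr (a * v0) * u.
have cF : c \in Fq by exact: Tr_Fq.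
have avE : Tr (a * v) = 0.
  by rewrite /v mulrBr TrD TrN mulrCA (TrZ _ (Tr_Fq _)) uE mulr1 subrr.
have bvE : Tr (b * v) = 1.
  rewrite /v mulrBr TrD TrN mulrCA (TrZ _ (Tr_Fq _)) -/c -v0E mulrBl TrD TrN.
  by rewrite -mulrA (TrZ _ cF) [c * _]mulrC.
clearbody v.
have := @card_transversal [set v | Tr (a * v) == 0]
  [set v | (Tr (a * v) == 0) && (Tr (b * v) == 0)] v.
rewrite card_hyperplane // [(q ^ 3)%N]expnSr => /(_ _ _ _ _ _)/eqP.
rewrite eqn_pmul2r ?(ltnW q_gt1) // => h; apply/esym/eqP/h => //.
- by apply/eqP => v00; move: bvE; rewrite v00 mulr0 Tr0 => /esym/eqP; rewrite oner_eq0.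
- by apply/subsetP => x; rewrite !inE => /andP[].
- move=> x t; rewrite !inE => /eqP xE tF.
  by rewrite mulrDr TrD mulrCA (TrZ _ tF) xE avE mulr0 addr0.
- move=> x; rewrite inE => /eqP xE; exists (- Tr (b * x)); first exact/FqN/Tr_Fq.
  rewrite inE !mulrDr !TrD mulrCA [b * (_ * v)]mulrCA !(TrZ _ (FqN (Tr_Fq _))) xE avE bvE.
  by rewrite mulr0 mulr1 addr0 subrr eqxx.
- move=> x t; rewrite !inE => /andP[/eqP xE /eqP yE] tF /andP[_].
  by rewrite mulrDr TrD mulrCA (TrZ _ tF) yE bvE add0r mulr1 => /eqP.
Qed.

(** * The relative norm and the ovoid *)

Lemma fr2E x : fr (fr x) = x ^+ (q ^ 2).
Proof. by rewrite /fr -exprM mulnn. Qed.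

Lemma N2E x : N2 x = x ^+ (q ^ 2).+1.
Proof. by rewrite exprS -fr2E. Qed.

(** The set holds vectors: each projective point of the quadric appears as its [q - 1] nonzero
    multiples. This makes it a subgroup of the multiplicative group, whose translations act
    transitively on the points. *)
Definition ovoid := [set x : L | (x != 0) && (N2 x \in Fq)].

Lemma ovoidP x : reflect (x != 0 /\ N2 x \in Fq) (x \in ovoid).
Proof. by rewrite inE; exact: andP. Qed.

Lemma N2M x y : N2 (x * y) = N2 x * N2 y.
Proof. by rewrite /N2 !fr_mul; ring. Qed.

Lemma ovoidM x y : x \in ovoid -> y \in ovoid -> x * y \in ovoid.
Proof.
by rewrite !inE N2M => /andP[x0 xF] /andP[y0 yF]; rewrite mulf_neq0 // (FqM xF yF).
Qed.

Lemma Fq_ovoid t : t \in Fq -> t != 0 -> t \in ovoid.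
Proof. by move=> /[dup] tF /FqP e t0; rewrite inE t0 /N2 !e; exact: (FqM tF tF). Qed.

Lemma ovoidV x : x \in ovoid -> x^-1 \in ovoid.
Proof.
by rewrite !inE /N2 invr_eq0 !fr_inv -invfM => /andP[-> /FqV].
Qed.

Lemma ovoid_neq0 x : x \in ovoid -> x != 0.
Proof. by rewrite inE => /andP[]. Qed.

Lemma ovoidE : ovoid = [set x | x ^+ (q.-1 * (q ^ 2).+1) == 1].
Proof.
apply/setP => x; rewrite [LHS]inE [RHS]inE mulnC exprM.
rewrite -N2E.
have N0 : (N2 x != 0) = (x != 0) by rewrite /N2 mulf_eq0 !fr_eq0 orbb.
by apply/andP/Fq_unitP; rewrite N0.
Qed.

Lemma card_ovoid : #|ovoid| = (q.-1 * (q ^ 2).+1)%N.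
Proof.
rewrite ovoidE card_unity_roots //; first by rewrite muln_gt0 -subn1 subn_gt0 q_gt1.
by rewrite cardL predq4 mulnCA dvdn_mull.
Qed.

(* [w] and [fr (fr w)] are the roots of a quadratic over [Fq], so that the root
   [fr w] is one of them; either way [fr w = w]. *)
Lemma Fq_of_T2_N2 w : T2 w \in Fq -> N2 w \in Fq -> w \in Fq.
Proof.
move=> /FqP hT /FqP hN.
have : (fr w - w) * (fr w - fr (fr w)) = 0.
  have -> : (fr w - w) * (fr w - fr (fr w)) =
            fr w ^+ 2 - T2 w * fr w + N2 w by rewrite /T2 /N2; ring.
  by rewrite -hT -hN /T2 /N2 !frE; ring.
move/eqP; rewrite mulf_eq0 !subr_eq0 => /orP[]/eqP e; apply/FqP => //.
exact/fr_inj/esym.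
Qed.

(** Any [z] in F_{q^2} outside F_q gives [fr z - z]; such a [z] exists by counting. This [eta] will
    define the tangent plane at 1. *)
Lemma ex_skew : exists2 eta : L, eta != 0 & fr eta = - eta.
Proof.
have [z [z2 z1]] : exists z : L, fr (fr z) = z /\ fr z != z.
  pose K := [set x : L | x ^+ (q ^ 2).-1 == 1].
  have qq : (q.-1 < (q ^ 2).-1)%N by rewrite -mulnn; nia.
  have cK : #|K| = (q ^ 2).-1.
    apply: card_unity_roots; first exact: leq_ltn_trans qq.
    rewrite cardL (_ : (q ^ 4).-1 = ((q ^ 2).-1 * (q ^ 2).+1)%N) ?dvdn_mulr //.
    by rewrite predq4 mulnA; congr (_ * _)%N; rewrite -mulnn; nia.
  have /subsetPn[z zK zF] : ~~ (K \subset [set x in Fq | x != 0]).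
    by apply: contraL qq => /subset_leq_card; rewrite cK card_Fq_unit -leqNgt.
  have zq : z ^+ (q ^ 2) = z.
    rewrite -(prednK (n := q ^ 2)) ?expn_gt0 ?(ltnW q_gt1) // exprS.
    by move: zK; rewrite inE => /eqP->; rewrite mulr1.
  exists z; split; first by rewrite fr2E.
  apply: contra zF => /eqP/FqP zF; rewrite !inE zF /=.
  apply: contraL zK => /eqP->; rewrite inE expr0n.
  by rewrite (gtn_eqF (leq_ltn_trans (leq0n _) qq)) eq_sym oner_neq0.
exists (fr z - z); first by rewrite subr_eq0.
by rewrite !fr_sub z2 opprB.
Qed.

(** * Plane sections of the quadric *)

Definition section a := [set x in ovoid | Tr (a * x) == 0].

Lemma sectionP a x : reflect (x \in ovoid /\ Tr (a * x) = 0) (x \in section a).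
Proof. by apply: (iffP setIdP) => -[? /eqP]. Qed.

Section Tangent.

Variable eta : L.
Hypothesis eta_neq0 : eta != 0.
Hypothesis fr_eta : fr eta = - eta.

(** [E] below is, up to a skew factor, the quadratic form whose nonzero zeros are the ovoid, and
    [beta] is its polar form against 1. Hence [beta v = 0] is the tangent plane at 1, the plane of
    [eta] by [Tr_eta]. *)
Let beta v := T2 v - fr (T2 v).
Let E v := N2 v - fr (N2 v).

Let Tr_eta v : Tr (eta * v) = eta * beta v.
Proof. by rewrite /Tr /beta /T2 !frE !(fr_eta, fr_opp); ring. Qed.

Let beta_shift x t : t \in Fq -> beta (x + t) = beta x.
Proof. by move=> /FqP e; rewrite /beta /T2 !frE !e; ring. Qed.

Let E_shift x t : t \in Fq -> E (x + t) = E x + t * beta x.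
Proof. by move=> /FqP e; rewrite /E /N2 /beta /T2 !frE !e; ring. Qed.

(* Stereographic projection from 1: every line through 1 in the plane [Tr (a * v) = 0]
   that is not tangent (i.e. [beta <> 0]) meets the ovoid in exactly one more point. *)
Lemma card_section1 a : a != 0 -> Tr a = 0 ->
  #|section a| = (if a / eta \in Fq then q.-1 else q.-1 * q.+1)%N.
Proof.
move=> a0 Ta0.
pose H := [set v | Tr (a * v) == 0].
pose U := [set v in H | beta v != 0].
pose W := [set v in U | E v == 0].
have HF x t : x \in H -> t \in Fq -> x + t \in H.
  rewrite !inE => /eqP xH tF.
  by rewrite mulrDr TrD [a * t]mulrC (TrZ _ tF) Ta0 mulr0 addr0 xH.
have fr_beta x : fr (beta x) = - beta x by rewrite /beta /T2 !frE; ring.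
have fr_E x : fr (E x) = - E x by rewrite /E /N2 !frE; ring.
have memU x : (x \in U) = (x \in H) && (beta x != 0) by rewrite inE.
have memW x : (x \in W) = (x \in U) && (E x == 0) by rewrite inE.
(* Along [x + t], [E] is affine in [t] with slope [beta x], nonzero on [U]. Its only zero is
   [- (E x / beta x)], in F_q because numerator and denominator are both skew. *)
have cU : #|U| = (#|W| * q)%N.
  apply: (@card_transversal _ _ 1); first exact: oner_neq0.
  - by apply/subsetP => x; rewrite memW => /andP[].
  - move=> x t; rewrite mulr1 !memU => /andP[xH bx] tF.
    by rewrite HF // beta_shift.
  - move=> x; rewrite memU => /andP[xH bx].
    have tF : - (E x / beta x) \in Fq.
      by apply/FqP; rewrite fr_opp fr_mul fr_inv fr_E fr_beta invrN mulrNN.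
    exists (- (E x / beta x)) => //.
    by rewrite mulr1 memW memU HF // beta_shift // bx E_shift // mulNr divfK // subrr /=.
  - move=> x t; rewrite mulr1 !memW memU => /andP[/andP[_ bx] /eqP Ex] tF /andP[_].
    by rewrite E_shift // Ex add0r mulf_eq0 (negPf bx) orbF => /eqP.
have N2_Fq x : (N2 x \in Fq) = (E x == 0).
  by apply/FqP/eqP => [e|/eqP]; [rewrite /E e subrr|rewrite subr_eq0 => /eqP].
have beta_Fq x : x \in Fq -> beta x = 0.
  by move=> /FqP e; rewrite /beta /T2 !frE !e subrr.
(* Where [beta x = 0], [T2 x] lies in F_q, so an ovoid vector there is in F_q by [Fq_of_T2_N2]. The
   other section vectors form [W]. *)
have secE : section a = [set x in Fq | x != 0] :|: W.
  apply/setP => x; rewrite in_setU memW memU !inE N2_Fq.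
  have [bx0|bx] := eqVneq (beta x) 0.
    rewrite andbF /= orbF; apply/idP/idP => [/andP[/andP[x0 Ex] _]|/andP[xF x0]].
      rewrite x0 andbT Fq_of_T2_N2 ?N2_Fq //.
      by apply/FqP/esym/eqP; rewrite -subr_eq0; apply/eqP.
    rewrite x0 -N2_Fq mulrC (TrZ _ xF) Ta0 mulr0 eqxx andbT /=.
    by have := Fq_ovoid xF x0; rewrite inE => /andP[].
  have x0 : x != 0 by apply: contraNneq bx => ->; rewrite beta_Fq ?Fq0.
  rewrite x0 !andbT /= andbC; case: (boolP (x \in Fq)) => //= /beta_Fq bx0.
  by rewrite bx0 eqxx in bx.
have csec : #|section a| = (q.-1 + #|W|)%N.
  rewrite secE cardsU card_Fq_unit (_ : _ :&: W = set0) ?cards0 ?subn0 //.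
  apply/setP => x; rewrite in_setI memW memU in_set0 !inE.
  by case: (boolP (x \in Fq)) => //= /beta_Fq ->; rewrite eqxx !andbF.
have cH : (#|[set v | ((Tr (a * v) == 0) && (Tr (eta * v) == 0))%R]| + #|U| = q ^ 3)%N.
  rewrite -(card_hyperplane a0) -[RHS](cardsID [set v | Tr (eta * v) == 0]).
  congr (_ + _)%N; apply: eq_card => x; rewrite !inE //.
  by rewrite Tr_eta mulf_eq0 (negPf eta_neq0) andbC.
(* If [a / eta] is in F_q, the plane is the tangent plane at 1 and [U] is empty. Otherwise the two
   planes share [q ^ 2] vectors, so [U] has [q ^ 3 - q ^ 2] elements and [W] has [q ^ 2 - q]. *)
case: ifPn => aF.
  suff U0 : #|U| = 0%N.
    by move: csec; rewrite U0 in cU; nia.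
  apply/eqP; rewrite cards_eq0; apply/eqP/setP => x; rewrite memU in_set0 inE.
  apply/negP => /andP[]; have := TrZ (eta * x) aF.
  rewrite mulrA divfK // => ->; rewrite Tr_eta.
  rewrite !mulf_eq0 (negPf a0) (negPf eta_neq0) invr_eq0 (negPf eta_neq0) /=.
  by move=> ->.
move: cH; rewrite card_hyperplaneI // => [cH|t tF].
  by rewrite csec; move: cH; rewrite cU !expnS expn0; nia.
apply: contra aF => /eqP ->; case: (eqVneq t 0) => [->|t0].
  by rewrite mul0r invr0 mulr0 Fq0.
by rewrite invfM mulrCA divff // mulr1 FqV.
Qed.

Let Fq_beta x : x \in ovoid -> Tr (eta * x) = 0 -> x \in Fq.
Proof.
move=> /ovoidP[_ xN] /eqP; rewrite Tr_eta mulf_eq0 (negPf eta_neq0) subr_eq0 => /eqP bx.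
by apply: Fq_of_T2_N2 => //; exact/FqP/esym.
Qed.

(** Multiplication by [x^-1] preserves the ovoid and moves the section to one through 1, with [a]
    replaced by [a * x]; then [card_section1] applies. *)
Lemma card_section a x : x \in section a -> a != 0 ->
  #|section a| = (if a / eta \in ovoid then q.-1 else q.-1 * q.+1)%N.
Proof.
move=> /sectionP[xO Tx] a0; have x0 := ovoid_neq0 xO.
have -> : (a / eta \in ovoid) = (a * x / eta \in Fq).
  apply/idP/idP => [aO|axF].
    rewrite mulrAC; apply: Fq_beta; first exact: ovoidM.
    by rewrite mulrA [eta * _]mulrC divfK.
  rewrite -[a](mulfK x0) mulrAC; apply: ovoidM; last exact: ovoidV.
  by apply: Fq_ovoid => //; rewrite !mulf_neq0 ?invr_eq0.
rewrite -card_section1 ?mulf_neq0 // -[RHS](card_imset _ (mulfI x0)).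
apply: eq_card => y; apply/sectionP/imsetP => [[yO Ty]|[z /sectionP[zO Tz] ->]].
  exists (x^-1 * y); last by rewrite mulVKf.
  by apply/sectionP; split; [apply: ovoidM => //; exact: ovoidV|rewrite -mulrA mulVKf].
by split; [exact: ovoidM|rewrite mulrA].
Qed.

(** The point of tangency is [eta / a]: its product with [a] is [eta], whose trace is an alternating
    sum. *)
Lemma tangent_section a : a / eta \in ovoid -> section a != set0.
Proof.
move=> aO; apply/set0Pn; exists (a / eta)^-1; apply/sectionP.
have a0 : a != 0 by move: (ovoid_neq0 aO); rewrite mulf_eq0 negb_or => /andP[].
split; first exact: ovoidV.
by rewrite invf_div mulrC divfK // /Tr !(fr_eta, fr_opp) opprK subrK subrr.
Qed.

End Tangent.

(** Double counting of incidences: each ovoid vector lies in the planes of [q ^ 3 - 1] nonzero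
    [a]. *)
Lemma sum_card_section :
  (\sum_(a | a != 0%R) #|section a| = #|ovoid| * (q ^ 3).-1)%N.
Proof.
transitivity (\sum_(a : L | a != 0%R) \sum_(x in ovoid) (Tr (a * x) == 0%R))%N.
  apply: eq_bigr => a _; rewrite -sum1_card [RHS]big_mkcond [LHS]big_mkcond.
  by apply: eq_bigr => x _; rewrite in_set; case: (x \in ovoid); case: (_ == _).
rewrite exchange_big /= -sum_nat_const; apply: eq_bigr => x xO.
have x0 := ovoid_neq0 xO.
rewrite -(card_hyperplane x0) (cardsD1 0) inE mulr0 Tr0 eqxx /= -sum1_card.
rewrite [RHS]big_mkcond [LHS]big_mkcond /=; apply: eq_bigr => a _.
by rewrite !inE mulrC; case: (a != 0); case: (_ == _).
Qed.

(* The sections of cardinality [q.-1] are those by the tangent planes, one for each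
   point of the ovoid.  Double counting the incidences then leaves no room for planes
   that miss the ovoid. *)
Lemma section_distribution :
  (forall a, a != 0 -> #|section a| = q.-1 \/ #|section a| = (q.-1 * q.+1)%N) /\
  #|[set a | (a != 0) && (#|section a| == q.-1)]| = #|ovoid|.
Proof.
have [eta eta0 fr_eta] := ex_skew.
(* [A1], [A2] and [A0] collect the tangent planes, the planes meeting the quadric in [q + 1] points,
   and the planes missing it. *)
pose A1 := [set a | a / eta \in ovoid].
pose A2 := [set a | [&& a != 0, a \notin A1 & section a != set0]].
pose A0 := [set a | (a != 0) && (section a == set0)].
have memA2 a : (a \in A2) = [&& a != 0, a \notin A1 & section a != set0].
  by rewrite in_set.
have memA0 a : (a \in A0) = (a != 0) && (section a == set0) by rewrite in_set.
have q1 : (0 < q.-1)%N by lia.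
have A1_neq0 a : a \in A1 -> a != 0.
  by rewrite inE => /ovoid_neq0; rewrite mulf_eq0 negb_or => /andP[].
have s1 a : a \in A1 -> #|section a| = q.-1.
  move=> aA; have [x xS] : exists x, x \in section a.
    by apply/set0Pn; apply: tangent_section fr_eta _ _; rewrite inE in aA.
  rewrite (card_section eta0 fr_eta xS) ?A1_neq0 //.
  by move: aA; rewrite inE => ->.
have s2 a : a \in A2 -> #|section a| = (q.-1 * q.+1)%N.
  rewrite in_set => /and3P[a0 aA /set0Pn[x xS]]; rewrite in_set in aA.
  by rewrite (card_section eta0 fr_eta xS) // (negPf aA).
have s0 a : a \in A0 -> #|section a| = 0%N.
  by rewrite inE => /andP[_ /eqP->]; rewrite cards0.
have cA1 : #|A1| = #|ovoid|.
  rewrite -(card_imset ovoid (mulIf eta0)); apply: eq_card => a.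
  rewrite inE; apply/idP/imsetP => [aO|[x xO ->]]; last by rewrite mulfK.
  by exists (a / eta) => //; rewrite divfK.
have disj : [set a | a != 0] = A1 :|: A2 :|: A0.
  apply/setP => a; rewrite 2!in_setU memA2 memA0 inE; have := A1_neq0 a.
  by case: (a \in A1) => [->//|_]; case: (a == 0) => //=; case: (_ == _).
have d12 : [disjoint A1 & A2].
  rewrite -setI_eq0; apply/eqP/setP => a; rewrite in_setI memA2 in_set0.
  by case: (a \in A1); rewrite //= andbF.
have d0 : [disjoint A1 :|: A2 & A0].
  rewrite -setI_eq0; apply/eqP/setP => a; rewrite in_setI in_set0.
  apply/negP => /andP[/setUP aA /s0 c0].
  by case: aA => [/s1|/s2]; rewrite c0; nia.
have cA : (#|A1| + #|A2| + #|A0| = (q ^ 4).-1)%N.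
  have cd (X Y : {set L}) : [disjoint X & Y] -> #|X :|: Y| = (#|X| + #|Y|)%N.
    by rewrite -setI_eq0 cardsU => /eqP->; rewrite cards0 subn0.
  rewrite -cd // -cd // -disj -cardL -(cardC1 (0 : L)).
  by apply: eq_card => a; rewrite !inE.
have sA : (#|A1| * q.-1 + #|A2| * (q.-1 * q.+1) = #|ovoid| * (q ^ 3).-1)%N.
  have sumU (X Y : {set L}) : [disjoint X & Y] -> (\sum_(a in X :|: Y) #|section a| =
      \sum_(a in X) #|section a| + \sum_(a in Y) #|section a|)%N.
    by move=> d; rewrite -bigU //; apply: eq_bigl => a; rewrite in_setU.
  rewrite -sum_card_section (eq_bigl (mem (A1 :|: A2 :|: A0))); last first.
    by move=> a /=; rewrite -disj inE.
  rewrite !sumU // -!sum_nat_const -[LHS]addn0; congr (_ + _ + _)%N.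
  - by apply/esym/eq_bigr.
  - by apply/esym/eq_bigr.
  - by rewrite big1.
(* The incidence count forces [A2] to be [q] times as large as the ovoid, and [#|ovoid| * (1 + q)]
   is already [q ^ 4 - 1]. *)
have A00 : A0 = set0.
  have q3 : (q ^ 3).-1 = (q.-1 * (q * q.+1).+1)%N.
    case: q q_gt1 => // k _.
    by have -> : (k.+1 ^ 3 = (k * (k.+1 * k.+2).+1).+1)%N by ring.
  have cA2 : #|A2| = (#|ovoid| * q)%N.
    apply/eqP; rewrite -(eqn_pmul2r (m := q.-1 * q.+1)) ?muln_gt0 ?q1 //.
    rewrite -(eqn_add2l (#|A1| * q.-1)) sA cA1 q3.
    by apply/eqP; ring.
  apply/eqP; rewrite -cards_eq0 -(eqn_add2l (#|A1| + #|A2|)) cA cA2 cA1 card_ovoid predq4.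
  by apply/eqP; ring.
have cov a : a != 0 -> a \in A1 \/ a \in A2.
  by move=> a0; have /setP/(_ a) := disj; rewrite A00 setU0 inE a0 => /esym/setUP.
split=> [a /cov[/s1|/s2]|]; [by left|by right|].
rewrite -cA1; apply: eq_card => a; rewrite inE; apply/andP/idP => [[/cov[//|/s2->]]|aA].
  by nia.
by rewrite A1_neq0 // s1.
Qed.

(** * The code and its dual *)

Section Code.

Hypothesis q_gt2 : (2 < q)%N.
Hypothesis q_eq0 : q%:R = 0 :> L.

Local Notation n := ((q ^ 2).+1).

Variables (lam delta : L).
Hypothesis lamF : lam \in Fq.
Hypothesis delta_lam : delta ^+ n = lam.
Hypothesis delta_neq0 : delta != 0.
Hypothesis delta_Fq : forall i, delta ^+ i \in Fq -> (n %| i)%N.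

(** * The points [delta ^- i] and the weights of trace words *)

Lemma delta_ovoid i : delta ^- i \in ovoid.
Proof.
have dO : delta \in ovoid.
  by apply/ovoidP; rewrite N2E delta_lam.
elim: i => [|i IH]; last by rewrite exprSr invfM; exact: ovoidM IH (ovoidV dO).
by rewrite invr1 Fq_ovoid ?Fq1 ?oner_neq0.
Qed.

Lemma n_ge : (9 < n)%N.
Proof. by rewrite ltnS -[9%N]/(3 ^ 2)%N leq_exp2r. Qed.

Lemma fr_delta_neq : fr delta != delta.
Proof.
apply/negP => /eqP/FqP; rewrite -[delta]expr1 => /delta_Fq /dvdn_leq.
by move=> /(_ isT); have := n_ge; lia.
Qed.

(** Otherwise [delta ^+ 2] would be [N2 delta = lam], in F_q, although [n] does not divide 2. *)
Lemma fr2_delta_neq : fr (fr delta) != delta.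
Proof.
apply/negP => /eqP e; suff /delta_Fq/dvdn_leq : delta ^+ 2 \in Fq.
  by move=> /(_ isT); have := n_ge; lia.
by rewrite expr2 -{2}e -/(N2 _) N2E delta_lam.
Qed.

(** Two equal projective points would put [delta ^+ (j - i)] in F_q with [j - i < n], so [delta_Fq]
    forces [j - i = 0]. *)
Lemma point_inj (i j : 'I_n) t s :
  t \in Fq -> t != 0 -> s \in Fq -> s != 0 ->
  t * delta ^- i = s * delta ^- j -> i = j.
Proof.
wlog le_ij : i j t s / (i <= j)%N.
  move=> H tF t0 sF s0 e; case: (leqP i j) => [le|/ltnW le]; first exact: (H i j t s).
  by apply/esym/(H j i s t).
move=> tF t0 sF s0 e; apply: val_inj; apply/eqP; rewrite /= eqn_leq le_ij /=.
have : delta ^+ (j - i) \in Fq.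
  suff -> : delta ^+ (j - i) = s / t by rewrite FqM ?FqV.
  have di := expf_neq0 i delta_neq0; have dj := expf_neq0 j delta_neq0.
  apply: (mulIf t0); rewrite divfK // -[s](mulfK dj) mulrAC -e.
  have dE : delta ^+ j = delta ^+ (j - i) * delta ^+ i by rewrite -exprD subnK.
  by rewrite dE mulrCA divfK // mulrC.
move=> /delta_Fq/dvdn_leq; rewrite subn_gt0; have := ltn_ord j; lia.
Qed.

Definition zeros a := [set i : 'I_n | Tr (a * delta ^- i) == 0].

(** The [n] distinct points [delta ^- i], with [q - 1] multiples each, exhaust the ovoid by
    cardinality. A multiple by F_q^* does not change whether the trace vanishes. *)
Lemma card_section_zeros a : #|section a| = (#|zeros a| * q.-1)%N.
Proof.
pose F1 := [set x in Fq | x != 0].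
pose f (u : 'I_n * L) := u.2 * delta ^- u.1.
have cF1 : #|F1| = q.-1 by apply: card_Fq_unit.
have memF1 x : (x \in F1) = (x \in Fq) && (x != 0) by rewrite in_set.
have f_inj (A : {set 'I_n}) : {in setX A F1 &, injective f}.
  move=> [i t] [j s] /setXP[/= _ +] /setXP[/= _ +].
  rewrite !memF1 /f /= => /andP[tF t0] /andP[sF s0] e.
  have ij := point_inj tF t0 sF s0 e; rewrite -ij in e *.
  by congr (_, _); apply: mulIf e; rewrite invr_eq0 expf_neq0.
have fO u : u \in setX setT F1 -> f u \in ovoid.
  case: u => i t /setXP[_]; rewrite memF1 => /andP[tF t0].
  exact: ovoidM (Fq_ovoid tF t0) (delta_ovoid i).
have ovoidE : ovoid = f @: setX setT F1.
  apply/esym/eqP; rewrite eqEcard card_in_imset; last exact: f_inj.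
  rewrite cardsX cardsT card_ord cF1 card_ovoid mulnC leqnn andbT.
  by apply/subsetP => _ /imsetP[u uX ->]; exact: fO.
rewrite -cF1 -cardsX -(card_in_imset (f_inj _)); apply: eq_card => x.
apply/sectionP/imsetP => [[]|[[i t] /setXP[/= iZ tF] ->]].
  rewrite {1}ovoidE => /imsetP[[i t] /setXP[/= _ tF] ->]; rewrite /f /= => Tx.
  exists (i, t) => //; apply/setXP; split => //=; rewrite inE.
  move: Tx tF; rewrite memF1 mulrCA => Tx /andP[tF t0]; move: Tx.
  by rewrite (TrZ _ tF) => /eqP; rewrite mulf_eq0 (negPf t0).
split; first by apply: fO; apply/setXP.
move: iZ tF; rewrite inE memF1 /f /= => /eqP iZ /andP[tF _].
by rewrite mulrCA (TrZ _ tF) iZ mulr0.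
Qed.

Definition trace_word a : 'rV[L]_n := \row_i Tr (a * delta ^- i).

Lemma hweight_trace_word a : (hweight (trace_word a) + #|zeros a| = n)%N.
Proof.
rewrite -[RHS]card_ord -(cardC (mem (zeros a))) addnC; congr (_ + _)%N.
by apply: eq_card => i; rewrite !inE mxE.
Qed.

Lemma trace_word_weights a : a != 0 ->
  hweight (trace_word a) = (if #|section a| == q.-1 then q ^ 2 else q ^ 2 - q)%N.
Proof.
move=> a0; have [sd _] := section_distribution.
have := hweight_trace_word a; have := sd a a0; rewrite card_section_zeros.
have q1 : (0 < q.-1)%N by lia.
case=> [|] e; rewrite e.
  have -> : #|zeros a| = 1%N by apply/eqP; rewrite -(eqn_pmul2r q1) e mul1n.
  by rewrite eqxx addn1 => -[].
have -> : #|zeros a| = q.+1 by apply/eqP; rewrite -(eqn_pmul2r q1) e mulnC.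
have -> : (q.-1 * q.+1 == q.-1)%N = false by nia.
move=> /(canRL (addnK _)) ->.
by rewrite subSS.
Qed.

Lemma trace_word0 : trace_word 0 = 0.
Proof. by apply/rowP => i; rewrite !mxE mul0r Tr0. Qed.

Lemma card_trace_word_weight i :
  #|[set a | hweight (trace_word a) == i]| =
    (if i == 0 then 1
     else if i == q ^ 2 - q then (q ^ 2 - q) * (q ^ 2 + 1)
     else if i == q ^ 2 then (q - 1) * (q ^ 2 + 1)
     else 0)%N.
Proof.
have [_] := section_distribution.
rewrite card_ovoid.
pose A1 := [set a | (a != 0) && (#|section a| == q.-1)].
pose A2 := [set a | (a != 0) && (#|section a| != q.-1)].
rewrite -/A1 => cA1.
have cA2 : (#|A1| + #|A2| = (q ^ 4).-1)%N.
  rewrite -cardL -(cardC1 (0 : L)) -[RHS](cardID (mem A1)); congr (_ + _)%N.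
    by apply: eq_card => a; rewrite !inE; case: (a != 0).
  by apply: eq_card => a; rewrite !inE; case: (a != 0); case: (_ == q.-1).
have w0 : hweight (trace_word 0) = 0%N by rewrite trace_word0 hweight0.
have w a : hweight (trace_word a) =
    (if a == 0%R then 0 else if a \in A1 then q ^ 2 else q ^ 2 - q)%N.
  have [->//|a0] := eqVneq a 0; rewrite trace_word_weights // inE a0 //=.
have qq : (0 < q ^ 2 - q < q ^ 2)%N by rewrite -mulnn; nia.
have [->|i0] := eqVneq i 0%N.
  transitivity #|[set (0 : L)]|; last exact: cards1.
  apply: eq_card => a; rewrite !inE w.
  by have [//|a0] := eqVneq a 0; case: ifP => _; lia.
have [->|i1] := eqVneq i (q ^ 2 - q)%N.
  transitivity #|A2|.
    apply: eq_card => a; rewrite !inE w; have [//|a0] := eqVneq a 0; first lia.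
    by rewrite inE a0 /=; case: ifP => _; lia.
  (* The larger class is what remains of the [q ^ 4 - 1] nonzero [a] after the tangent planes. *)
  apply/eqP; rewrite -(eqn_add2l #|A1|) cA2 predq4 cA1; apply/eqP.
  have -> : (q ^ 2 - q = q * q.-1)%N by rewrite -mulnn; nia.
  by ring.
have [->|i2] := eqVneq i (q ^ 2)%N.
  rewrite addn1 subn1 -cA1; apply: eq_card => a; rewrite !inE w.
  have [//|a0] := eqVneq a 0; first lia.
  by rewrite inE a0 /=; case: ifP => _; lia.
apply/eqP; rewrite cards_eq0; apply/eqP/setP => a; rewrite !inE w.
by case: ifP => _; [|case: ifP => _]; lia.
Qed.

(** * Evaluation at the roots of ['X^n - lam%:P] *)

Lemma n_eq1 : n%:R = 1 :> L.
Proof. by rewrite mulrSr natrX q_eq0 expr0n add0r. Qed.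

Lemma geometric_sum b c : b ^+ n = lam -> c ^+ n = lam ->
  \sum_(i < n) (b / c) ^+ i = (b == c)%:R.
Proof.
move=> bn cn.
have c0 : c != 0.
  by apply: contra_neq (expf_neq0 n delta_neq0) => c0; rewrite delta_lam -cn c0 expr0n.
have [->|bc] := eqVneq b c.
  rewrite divff // (eq_bigr (fun _ => 1)) => [|i _]; last exact: expr1n.
  by rewrite sumr_const card_ord n_eq1.
apply: (mulfI (x := b / c - 1)).
  by rewrite subr_eq0 -(inj_eq (mulIf c0)) divfK // mul1r.
by rewrite -subrX1 expr_div_n bn cn divff ?subrr ?mulr0 // -cn expf_neq0.
Qed.

Lemma fr_root b : b ^+ n = lam -> fr b ^+ n = lam.
Proof. by move=> bn; rewrite -fr_exp bn; apply/FqP. Qed.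

Lemma horner_word_poly k (c : 'rV[L]_k) b :
  (word_poly c).[b] = \sum_(i < k) c 0 i * b ^+ i.
Proof.
by rewrite horner_sum; apply: eq_bigr => i _; rewrite hornerZ hornerXn.
Qed.

(** The Fourier transform of a trace word: by orthogonality it is supported on the conjugates of
    [delta], with the conjugates of [a] as values. No factor [1 / n] appears since [n = 1] in
    [L]. *)
Lemma horner_trace_word a b : b ^+ n = lam ->
  (word_poly (trace_word a)).[b] =
    a * (b == delta)%:R + fr a * (b == fr delta)%:R +
    fr (fr a) * (b == fr (fr delta))%:R + fr (fr (fr a)) * (b == fr (fr (fr delta)))%:R.
Proof.
move=> bn; rewrite horner_word_poly.
have d1 := fr_root delta_lam; have d2 := fr_root d1; have d3 := fr_root d2.
rewrite -!geometric_sum // !mulr_sumr -!big_split /=; apply: eq_bigr => i _.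
by rewrite mxE /Tr !(fr_mul, fr_inv, fr_exp) !expr_div_n; ring.
Qed.

(** Listed in the order in which the factors of the check polynomial give them. *)
Definition conjugates :=
  [:: delta; fr (fr delta); fr (fr (fr delta)); fr delta].

Lemma uniq_conjugates : uniq conjugates.
Proof.
have f1 : (delta == fr delta) = false by rewrite eq_sym (negPf fr_delta_neq).
have f2 : (delta == fr (fr delta)) = false by rewrite eq_sym (negPf fr2_delta_neq).
have f3 : (delta == fr (fr (fr delta))) = false.
  by rewrite -(inj_eq fr_inj) fr4 (negPf fr_delta_neq).
by rewrite /= !inE !(inj_eq fr_inj) f1 f2 f3 (negPf fr_delta_neq) (negPf fr2_delta_neq).
Qed.

Lemma conjugates_root b : b \in conjugates -> b ^+ n = lam.
Proof.
have d1 := fr_root delta_lam; have d2 := fr_root d1; have d3 := fr_root d2.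
by rewrite !inE => /or4P[]/eqP->.
Qed.

Lemma XnsubC_roots : exists rs,
  [/\ uniq rs, forall b, b \in rs -> b ^+ n = lam &
      'X^n - lam%:P = \prod_(z <- rs) ('X - z%:P)].
Proof.
(* [delta ^+ q.-1] is an [n]-th root of unity because [lam ^+ q.-1 = 1]. Two equal powers of it
   would make a ratio of powers of [delta] lie in F_q^*, against [point_inj]. *)
pose rs := [seq delta * (delta ^+ q.-1) ^+ (i : 'I_n) | i <- enum 'I_n].
have lam0 : lam != 0 by rewrite -delta_lam expf_neq0.
have urs : uniq rs.
  rewrite map_inj_in_uniq ?enum_uniq // => i j _ _ /(mulfI delta_neq0) e.
  have di := expf_neq0 i delta_neq0; have dj := expf_neq0 j delta_neq0.
  apply/esym; apply: (@point_inj j i (delta ^+ j / delta ^+ i) 1).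
  - suff /eqP/Fq_unitP[] : (delta ^+ j / delta ^+ i) ^+ q.-1 = 1 by [].
    by rewrite expr_div_n (exprAC _ j) (exprAC _ i) e divff // !expf_neq0.
  - by rewrite mulf_neq0 ?invr_eq0.
  - exact: Fq1.
  - exact: oner_neq0.
  - by rewrite mul1r mulrAC divff // mul1r.
have rsP b : b \in rs -> b ^+ n = lam.
  move=> /mapP[i _ ->]; rewrite exprMn delta_lam -!exprM [(q.-1 * _ * _)%N]mulnC exprM.
  rewrite delta_lam exprM; have /eqP-> : lam ^+ q.-1 == 1 by apply/Fq_unitP.
  by rewrite expr1n mulr1.
exists rs; split=> //.
have sz : size ('X^n - lam%:P) = n.+1 by rewrite size_XnsubC.
rewrite [LHS](@all_roots_prod_XsubC _ _ rs) ?uniq_rootsE //.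
- by rewrite (monicP (monicXnsubC _ _)) ?scale1r.
- by rewrite sz size_map size_enum_ord.
- by apply/allP => b /rsP bn; rewrite rootE !hornerE ?hornerXn bn subrr.
Qed.

Let h := \prod_(z <- conjugates) ('X - z%:P).

Lemma root_h b : root h b = (b \in conjugates).
Proof. exact: root_prod_XsubC. Qed.

(** All roots of ['X^n - lam%:P] are simple and lie in [L], so divisibility by the generator is
    vanishing at the roots that [h] leaves over. *)
Lemma constacyclic_dvdP (c : 'rV[L]_n) :
  (('X^n - lam%:P) %/ h) %| word_poly c <->
  (forall b, b ^+ n = lam -> b \notin conjugates -> (word_poly c).[b] = 0).
Proof.
have [rs [urs rsP PE]] := XnsubC_roots.
set P := 'X^n - lam%:P in PE *.
have rootP b : root P b = (b ^+ n == lam).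
  by rewrite rootE /P !hornerE ?hornerXn subr_eq0.
have hP : h %| P.
  apply: uniq_roots_dvdp; rewrite ?uniq_rootsE ?uniq_conjugates //.
  by apply/allP => b /conjugates_root bn; rewrite rootP bn.
split=> [/dvdpP[u uE] b bn bh|cE].
  have : root P b by rewrite rootP bn.
  rewrite -(divpK hP) rootM root_h (negPf bh) orbF rootE => /eqP gb.
  by rewrite uE hornerM gb mulr0.
have h0 : h != 0 by apply/monic_neq0/monic_prod_XsubC.
rewrite -(dvdp_mul2r _ _ h0) divpK // PE.
apply: uniq_roots_dvdp; rewrite ?uniq_rootsE //.
apply/allP => b /rsP bn; rewrite rootM root_h.
case: (boolP (b \in conjugates)) => bh; first by rewrite orbT.
by rewrite orbF rootE cE.
Qed.

Lemma word_poly_eq (c d : 'rV[L]_n) :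
  (forall b, b ^+ n = lam -> (word_poly c).[b] = (word_poly d).[b]) -> c = d.
Proof.
move=> cd; have [rs [urs rsP PE]] := XnsubC_roots.
have szrs : size rs = n.
  by apply: succn_inj; rewrite -(size_prod_XsubC rs id) -PE size_XnsubC.
apply/eqP; rewrite -subr_eq0 -(inj_eq (can_inj rVpolyK)) linear0.
apply/eqP; apply: (@roots_geq_poly_eq0 _ _ rs) => //.
  apply/allP => b /rsP bn; rewrite rootE linearB /= -!word_polyE.
  by rewrite hornerD hornerN cd // subrr.
by rewrite szrs size_poly.
Qed.

Lemma trace_word_inj : injective trace_word.
Proof.
move=> a b e; have := horner_trace_word a delta_lam.
rewrite e (horner_trace_word _ delta_lam); have := uniq_conjugates.
rewrite /= !inE !negb_or -!andbA eqxx => /and4P[/negPf-> /negPf-> /negPf-> _].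
by rewrite !mulr0 !addr0 !mulr1.
Qed.

(** A word is determined by its values at the roots of ['X^n - lam%:P]. For a codeword over F_q
    these vanish off the conjugates, and Frobenius derives the values on them from the one at
    [delta], which serves as [a]. *)
Lemma trace_codeE :
  subfield_subcode q (constacyclic_code (q ^ 2) n lam h) = [set trace_word a | a in L].
Proof.
apply/setP => c; rewrite !inE; apply/idP/imsetP.
  move=> /andP[/andP[_ /constacyclic_dvdP cE] /forallP cF].
  exists (word_poly c).[delta] => //; apply: word_poly_eq => b bn.
  have fr_c x : fr (word_poly c).[x] = (word_poly c).[fr x].
    rewrite !horner_word_poly fr_sum; apply: eq_bigr => i _.
    by rewrite fr_mul fr_exp; congr (_ * _); apply/eqP/cF.
  rewrite horner_trace_word // !fr_c.
  have := uniq_conjugates; rewrite /= !inE !negb_or -!andbA.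
  move=> /and5P[d2 d3 d1 d23 /and3P[d21 d31 _]].
  have [|bc] := boolP (b \in conjugates); last first.
    rewrite cE //; move: bc.
    rewrite !inE !negb_or => /and4P[/negPf-> /negPf-> /negPf-> /negPf->].
    by rewrite !mulr0 !addr0.
  have sym (x y : L) : x != y -> (y == x) = false by rewrite eq_sym => /negPf.
  have neq := (negPf d1, negPf d2, negPf d3, negPf d21, negPf d31, negPf d23,
    sym _ _ d1, sym _ _ d2, sym _ _ d3, sym _ _ d21, sym _ _ d31, sym _ _ d23).
  by rewrite !inE => /or4P[]/eqP->; rewrite ?eqxx !neq !(mulr0, mulr1, addr0, add0r).
move=> [a _ ->]; rewrite -andbA; apply/and3P; split.
- apply/forallP => i; rewrite mxE /in_subfield -fr2E.
  by have /FqP e := Tr_Fq (a * delta ^- i); rewrite !e.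
- apply/constacyclic_dvdP => b bn; rewrite !inE !negb_or => /and4P[b1 b2 b3 b4].
  by rewrite horner_trace_word // (negPf b1) (negPf b2) (negPf b3) (negPf b4) !mulr0 !addr0.
- by apply/forallP => i; rewrite mxE; apply/eqP/FqP/Tr_Fq.
Qed.

(** * Syndromes and the dual code *)

Definition words_on k (S : {set 'I_k}) : {set 'rV[L]_k} :=
  [set y : 'rV_k | [forall i, (y 0 i \in Fq) && ((y 0 i != 0) ==> (i \in S))]].

Lemma words_onP k (S : {set 'I_k}) (y : 'rV[L]_k) :
  reflect ((forall i, y 0 i \in Fq) /\ (forall i, y 0 i != 0 -> i \in S))
          (y \in words_on S).
Proof.
rewrite inE; apply: (iffP forallP) => [yP|[yF yS] i].
  by split=> i; have /andP[? /implyP] := yP i.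
by rewrite yF; apply/implyP/yS.
Qed.

Lemma words_onB k (S : {set 'I_k}) x y :
  x \in words_on S -> y \in words_on S -> x - y \in words_on S.
Proof.
move=> /words_onP[xF xS] /words_onP[yF yS]; apply/words_onP.
split=> i; rewrite !mxE; first exact: FqB.
apply: contraR => iS; have /eqP-> : x 0 i == 0 by apply: contraR iS => /xS.
by have /eqP-> : y 0 i == 0 by [apply: contraR iS => /yS]; rewrite subrr.
Qed.

Lemma card_words_on k (S : {set 'I_k}) : #|words_on S| = (q ^ #|S|)%N.
Proof.
rewrite -[in RHS]card_Fq -(card_pffun_on 0).
rewrite -(card_imset _ (f := fun f : {ffun 'I_k -> L} => \row_i f i)).
  apply: eq_card => y; apply/words_onP/imsetP => [[yF yS]|[f /pffun_onP[fS fF] ->]].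
    exists [ffun i => y 0 i]; last by apply/rowP => i; rewrite mxE ffunE.
    apply/pffun_onP; split.
      by apply/supportP => i; rewrite ffunE; apply: contraNeq => /yS.
    by move=> _ /imageP[i _ ->]; rewrite ffunE.
  split=> i; rewrite mxE; last by move=> fi; apply: (subsetP fS).
  have [iS|iS] := boolP (i \in S); first by apply: fF; apply: image_f.
  by have /eqP -> : f i == 0 by [apply: contraR iS => fi; apply: (subsetP fS)]; exact: Fq0.
by move=> f g /rowP fg; apply/ffunP => i; have := fg i; rewrite !mxE.
Qed.

(** The linear combination of the points [delta ^- i] with coefficients [y]; one value in [L] packs
    four parity checks over F_q. *)
Definition syndrome k (y : 'rV[L]_k) := (word_poly y).[delta^-1].

Lemma syndromeE k (y : 'rV[L]_k) : syndrome y = \sum_(i < k) y 0 i * delta ^- i.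
Proof. by rewrite /syndrome horner_word_poly; under eq_bigr do rewrite exprVn. Qed.

Lemma syndromeD k : {morph @syndrome k : x y / x + y}.
Proof. by move=> x y; rewrite /syndrome !word_polyE linearD hornerD. Qed.

Lemma syndromeB k : {morph @syndrome k : x y / x - y}.
Proof. by move=> x y; rewrite /syndrome !word_polyE linearB hornerD hornerN. Qed.

Lemma Tr_syndrome k (y : 'rV[L]_k) a : (forall i, y 0 i \in Fq) ->
  Tr (a * syndrome y) = \sum_(i < k) Tr (a * delta ^- i) * y 0 i.
Proof.
move=> yF; rewrite syndromeE mulr_sumr Tr_sum; apply: eq_bigr => i _.
by rewrite mulrCA (TrZ _ (yF i)) mulrC.
Qed.

(** The inner product with [trace_word a] is [Tr (a * syndrome y)], so orthogonality for every [a]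
    means a zero syndrome, the trace form being nondegenerate. *)
Lemma dual_trace_codeE :
  dual_code q [set trace_word a | a in L] =
  [set y in words_on [set: 'I_n] | syndrome y == 0].
Proof.
apply/setP => y; rewrite !in_set.
apply/andP/andP => -[/forallP yF yC].
  have {}yF i : y 0 i \in Fq by apply/FqP/eqP/yF.
  split; first by apply/forallP => i; rewrite yF inE implybT.
  apply/eqP/Tr_nondeg => a; rewrite mulrC Tr_syndrome //.
  move: yC => /forall_inP/(_ (trace_word a)); rewrite imset_f // => /(_ isT)/eqP e.
  by rewrite -[RHS]e; apply: eq_bigr => i _; rewrite mxE.
have {}yF i : y 0 i \in Fq by have /andP[] := yF i.
split; first by apply/forallP => i; apply/eqP/FqP/yF.
apply/forall_inP => _ /imsetP[a _ ->].
under eq_bigr do rewrite mxE.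
by rewrite -Tr_syndrome // (eqP yC) mulr0 Tr0.
Qed.

Lemma fr_syndrome_root k (y : 'rV[L]_k) x : (forall i, y 0 i \in Fq) ->
  root (word_poly y) x -> root (word_poly y) (fr x).
Proof.
move=> yF /eqP yx; apply/eqP; rewrite -[RHS]fr0 -yx !horner_word_poly fr_sum.
by apply: eq_bigr => i _; rewrite fr_mul fr_exp; have /FqP-> := yF i.
Qed.

Let first4 := [set i : 'I_n | (i < 4)%N].

Lemma card_first4 : #|first4| = 4%N.
Proof.
have n4 : (4 <= n)%N by have := n_ge; lia.
have inj : injective (widen_ord n4) by move=> i j /(congr1 val) ij; apply: val_inj.
rewrite -[RHS]card_ord -(card_imset _ inj).
apply: eq_card => i; rewrite inE; apply/idP/imsetP => [i4|[j _ ->]]; last exact: ltn_ord j.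
by exists (Ordinal i4) => //; apply: val_inj.
Qed.

(** A difference with zero syndrome is a polynomial of degree below 4 over F_q vanishing at
    [delta^-1], hence at its four distinct conjugates. *)
Lemma syndrome_first4_inj : {in words_on first4 &, injective (@syndrome n)}.
Proof.
move=> x y xW yW e; apply/eqP; rewrite -subr_eq0.
have /words_onP[dF dS] := words_onB xW yW.
have d0 : root (word_poly (x - y)) delta^-1.
  by rewrite rootE -/(syndrome _) syndromeB e subrr.
rewrite -(inj_eq (can_inj rVpolyK)) linear0; apply/eqP.
apply: (@roots_geq_poly_eq0 _ _ [seq z^-1 | z <- conjugates]).
- have d1 := fr_syndrome_root dF d0; have d2 := fr_syndrome_root dF d1.
  have d3 := fr_syndrome_root dF d2; rewrite -word_polyE /= -!fr_inv.
  by rewrite d0 d1 d2 d3.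
- by rewrite map_inj_uniq ?uniq_conjugates //; exact: invr_inj.
rewrite size_map; apply/leq_sizeP => i i4; rewrite coef_rVpoly.
case: insubP => // j _ ji; apply/eqP; apply: contraTT i4 => /dS.
by rewrite inE ji -ltnNge.
Qed.

(** Syndromes of words on the first four positions take each value in [L] once, so these words form
    a complement of the dual code: every word over F_q is uniquely a difference [y - u]. *)
Lemma card_dual_trace_code :
  #|[set y in words_on [set: 'I_n] | syndrome y == 0]| = (q ^ (q ^ 2 - 3))%N.
Proof.
set K := [set y in _ | _]; pose W4 := words_on first4; pose W := words_on [set: 'I_n].
have cW4 : #|W4| = (q ^ 4)%N by rewrite card_words_on card_first4.
have onto s : exists2 u, u \in W4 & syndrome u = s.
  have : s \in [set syndrome u | u in W4].
    suff -> : [set syndrome u | u in W4] = setT by rewrite inE.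
    apply/eqP; rewrite eqEcard subsetT card_in_imset; last exact: syndrome_first4_inj.
    by rewrite cardsT cardL cW4 /=.
  by case/imsetP => u; exists u.
have W4W u : u \in W4 -> u \in W.
  by move=> /words_onP[uF _]; apply/words_onP; split=> // i _; rewrite inE.
have memK y : (y \in K) = (y \in W) && (syndrome y == 0) by rewrite in_set.
apply/eqP; rewrite -(eqn_pmul2r (m := q ^ 4)) ?expn_gt0 ?(ltnW q_gt1) // -expnD.
rewrite -[in X in X == _]cW4 -cardsX.
rewrite -(card_in_imset (f := fun u : 'rV[L]_n * 'rV[L]_n => u.1 - u.2)); last first.
  move=> [y u] [z v] /setXP[/= +] uW /setXP[/= +] vW.
  rewrite !memK => /andP[_ /eqP y0] /andP[_ /eqP z0] e.
  have : syndrome (y - u) = syndrome (z - v) by rewrite e.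
  rewrite !syndromeB y0 z0 !sub0r => /oppr_inj /(syndrome_first4_inj uW vW) uv.
  by move: e; rewrite uv => /addIr->.
have <- : #|[set: 'I_n]| = (q ^ 2 - 3 + 4)%N.
  by rewrite cardsT card_ord; have := n_ge; lia.
rewrite -card_words_on; apply/eqP/eq_card => w.
apply/imsetP/idP => [[[y u] /setXP[/= yK uW] ->]|wW].
  by apply: words_onB; [move: yK; rewrite memK => /andP[]|exact: W4W].
have [u uW su] := onto (- syndrome w).
have wuW : w + u \in W.
  have /words_onP[wF _] := wW; have /words_onP[uF _] := uW.
  by apply/words_onP; split=> i; rewrite ?inE // mxE FqD.
exists (w + u, u); last by rewrite /= addrK.
by apply/setXP; split; rewrite //= memK wuW syndromeD su subrr eqxx.
Qed.

(** Put [w = x / y], so that [z / y = - (1 + w)]. Expanding [N2 (1 + w)] shows that [T2 w] is in F_q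
    along with [N2 w], and [Fq_of_T2_N2] applies. *)
Lemma no_three_collinear x y z : x \in ovoid -> y \in ovoid -> z \in ovoid ->
  x + y + z = 0 -> x / y \in Fq.
Proof.
move=> xO yO zO /eqP; rewrite addr_eq0 => /eqP e; have y0 := ovoid_neq0 yO.
have /ovoidP[_ wN] : x / y \in ovoid by apply: ovoidM => //; exact: ovoidV.
apply: Fq_of_T2_N2 => //.
have /ovoidP[_ zN] : z / y \in ovoid by apply: ovoidM => //; exact: ovoidV.
have -> : T2 (x / y) = N2 (z / y) - 1 - N2 (x / y).
  have -> : z / y = - (1 + x / y).
    by rewrite -[z]opprK -e mulNr mulrDl divff // addrC.
  by rewrite /T2 /N2 !(fr_opp, fr_add, fr1); ring.
by rewrite !FqB ?Fq1.
Qed.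

Lemma syndrome_weight (y : 'rV[L]_n) : (forall i, y 0 i \in Fq) ->
  syndrome y = 0 -> y != 0 -> (4 <= hweight y)%N.
Proof.
move=> yF sy y0; rewrite leqNgt; apply/negP; rewrite /hweight.
set S := [set i | _].
have SP i : i \in enum S -> y 0 i != 0 by rewrite mem_enum inE.
pose pt i := y 0 i * delta ^- i.
have ptO i : i \in enum S -> pt i \in ovoid.
  by move=> /SP yi; apply: ovoidM; [exact: Fq_ovoid|exact: delta_ovoid].
have : \sum_(i <- enum S) pt i = 0.
  rewrite big_enum /= -[RHS]sy syndromeE [RHS](bigID (mem S)) /=.
  rewrite [X in _ + X]big1 ?addr0 //.
  by move=> i; rewrite inE negbK => /eqP->; rewrite mul0r.
rewrite cardE; have := enum_uniq S.
have dep i j t : i \in enum S -> j \in enum S -> t \in Fq -> t != 0 ->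
    pt i = t * pt j -> i = j.
  move=> iS jS tF t0; rewrite /pt mulrA; apply: point_inj; rewrite ?SP ?mulf_neq0 ?SP //.
  exact: FqM.
(* Cases on the support size: none contradicts [y != 0], one gives a zero ovoid vector, two give
   proportional points, three give collinear points. *)
case: (enum S) (mem_enum S) SP ptO dep => [|i [|j [|k []]]] //= memS SP ptO dep.
- move=> _ _ _; case/eqP: y0; apply/rowP => i; rewrite mxE; apply/eqP.
  by have := memS i; rewrite !inE => /esym/negbFE.
- rewrite big_seq1 => _ p0 _.
  by have := ovoid_neq0 (ptO i (mem_head _ _)); rewrite p0 eqxx.
- rewrite inE !big_cons big_nil addr0 => /andP[/eqP ij _] /eqP; rewrite addr_eq0 => /eqP e _.
  apply: ij; apply: (dep _ _ (-1)); rewrite ?oppr_eq0 ?oner_neq0 //.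
  - by rewrite inE eqxx.
  - by rewrite !inE eqxx orbT.
  - exact: FqN Fq1.
  by rewrite mulN1r.
rewrite !inE !big_cons big_nil addr0 addrA => /and3P[/norP[/eqP ij _] _ _] e _.
have iO : pt i \in ovoid by apply: ptO; rewrite !inE eqxx.
have jO : pt j \in ovoid by apply: ptO; rewrite !inE eqxx orbT.
have kO : pt k \in ovoid by apply: ptO; rewrite !inE eqxx !orbT.
apply: ij; apply: (dep _ _ (pt i / pt j)); rewrite ?inE ?eqxx ?orbT //.
- exact: no_three_collinear kO e.
- by rewrite mulf_neq0 ?invr_eq0 ?ovoid_neq0.
- by rewrite divfK ?ovoid_neq0.
Qed.

(* Four points of a plane section are linearly dependent, which gives a word of weight
   at most 4 in the dual code. *)
Lemma syndrome_weight4 : exists y : 'rV[L]_n,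
  [/\ forall i, y 0 i \in Fq, syndrome y = 0, y != 0 & hweight y = 4%N].
Proof.
have [a aP] : exists a, hweight (trace_word a) == (q ^ 2 - q)%N.
  have : (0 < #|[set a | hweight (trace_word a) == (q ^ 2 - q)%N]|)%N.
    by rewrite card_trace_word_weight eqxx; case: ifP => // _; rewrite -mulnn; nia.
  by case/card_gt0P => a; rewrite inE; exists a.
have qq : (q < q ^ 2)%N by rewrite -mulnn; nia.
have a0 : a != 0.
  apply: contraTneq aP => ->; rewrite trace_word0.
  by rewrite hweight0; lia.
(* There are [q + 1] zeros, at least four because [q > 2]. *)
have : (4 <= #|zeros a|)%N by have := hweight_trace_word a; rewrite (eqP aP); lia.
case/card_geqP => s [us ss sZ]; pose S := [set i in s].
have cS : #|S| = 4%N by rewrite cardsE (card_uniqP us).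
(* Pigeonhole: the [q ^ 4] words on [S] have their syndromes in a hyperplane of [q ^ 3] elements. *)
have : ~~ dinjectiveb (@syndrome n) (words_on S).
  apply/negP => /dinjectiveP inj.
  suff : (q ^ 4 <= q ^ 3)%N by rewrite leq_exp2l.
  rewrite -cS -card_words_on -(card_in_imset inj) -(card_hyperplane a0).
  apply/subset_leq_card/subsetP => _ /imsetP[y /words_onP[yF yS] ->].
  rewrite inE Tr_syndrome // big1 // => i _.
  have [->|/yS] := eqVneq (y 0 i) 0; first by rewrite mulr0.
  by rewrite inE => /sZ; rewrite inE => /eqP->; rewrite mul0r.
case/dinjectivePn => x xW [y /andP[/= yx yW] e].
have /words_onP[dF dS] := words_onB xW yW.
have d0 : x - y != 0 by rewrite subr_eq0 eq_sym.
have sd : syndrome (x - y) = 0 by rewrite syndromeB e subrr.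
exists (x - y); split => //; apply/eqP; rewrite eqn_leq syndrome_weight // andbT.
by rewrite -cS; apply/subset_leq_card/subsetP => i; rewrite inE => /dS.
Qed.

End Code.

End Ovoid.

(** With [q - 1 = s * r], the order of [delta] gives that [n = q ^ 2 + 1] divides [i * s]. The
    2-adic condition makes [s] odd, and [n = (q - 1) * (q + 1) + 2] leaves only 2 as a possible
    common prime, so [n] and [s] are coprime. *)
Lemma delta_power_Fq (L : finFieldType) (q r i : nat) (delta : L) :
  (2 < q)%N -> (r %| q.-1)%N -> logn 2 r = logn 2 q.-1 ->
  (r * (q ^ 2).+1).-primitive_root delta -> delta ^+ i \in Fq L q ->
  ((q ^ 2).+1 %| i)%N.
Proof.
move=> q_gt2 /dvdnP[s qE] log_r dP dF.
have q1 : (0 < q.-1)%N by lia.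
have [s0 r0] : (0 < s)%N /\ (0 < r)%N by move: q1; rewrite qE muln_gt0 => /andP[].
have delta0 : delta != 0.
  apply: contraTneq (oner_neq0 L) => d0; rewrite -(prim_expr_order dP) d0.
  by rewrite expr0n muln_eq0 (gtn_eqF r0) eqxx.
have : delta ^+ (i * q.-1) == 1.
  by rewrite exprM; apply/Fq_unitP; [lia|rewrite expf_neq0].
rewrite -(prim_order_dvd dP) qE mulnA [(r * _)%N]mulnC dvdn_pmul2r // Gauss_dvdl //.
have s_odd : ~~ (2 %| s)%N.
  move: log_r; rewrite qE lognM // -[X in (X %| _)%N]expn1 pfactor_dvdn //; lia.
have g2 : (gcdn (q ^ 2).+1 s %| 2)%N.
  have e : ((q ^ 2).+1 = q.-1 * q.+1 + 2)%N by rewrite -mulnn; nia.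
  have gq : (gcdn (q ^ 2).+1 s %| q.-1)%N by rewrite qE dvdn_mulr // dvdn_gcdr.
  by rewrite -(dvdn_addr _ (dvdn_mulr q.+1 gq)) -e dvdn_gcdl.
have /primeP[_ /(_ _ g2)/orP[//|/eqP g2E]] : prime 2 by [].
by case/negP: s_odd; rewrite -g2E dvdn_gcdr.
Qed.

Theorem theorem4p3 (p m q : nat) (L : finFieldType) (lam delta : L) (r : nat) :
  prime p -> (0 < m)%N -> q = (p ^ m)%N -> (2 < q)%N ->
  #|L| = (q ^ 4)%N ->
  in_subfield (q ^ 2) lam -> lam != 0 -> r.-primitive_root lam ->
  (r %| q.-1)%N -> logn 2 r = logn 2 q.-1 ->
  (r * (q ^ 2).+1).-primitive_root delta -> delta ^+ (q ^ 2).+1 = lam ->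
  let n := (q ^ 2).+1 in
  let g1 := ('X - delta%:P) * ('X - (delta ^+ (q ^ 2))%:P) in
  let g2 := ('X - (delta ^+ (q ^ 2 - q + 1))%:P) *
            ('X - (delta ^+ (q ^ 4 - q ^ 3 + q ^ 2))%:P) in
  let C := constacyclic_code (q ^ 2) n lam (g1 * g2) in
  let Cq := subfield_subcode q C in
  [/\ #|Cq| = (q ^ 4)%N,
      min_dist_is Cq (q ^ 2 - q)%N,
      (forall i : nat, wt_count Cq i =
         if i == 0%N then 1%N
         else if i == (q ^ 2 - q)%N then ((q ^ 2 - q) * (q ^ 2 + 1))%N
         else if i == (q ^ 2)%N then ((q - 1) * (q ^ 2 + 1))%N
         else 0%N),
      #|dual_code q Cq| = (q ^ (q ^ 2 - 3))%N &
      min_dist_is (dual_code q Cq) 4].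
Proof.
move=> p_pr m_gt0 qE q_gt2 cardL _ lam0 lam_r r_q log_r deltaP delta_lam n g1 g2 C Cq.
have q_gt1 : (1 < q)%N := ltnW q_gt2.
have pL : p \in [pchar L].
  by apply: (@card_finPcharP _ p (m * 4)) => //; rewrite cardL qE expnM.
have frD (x y : L) : (x + y) ^+ q = x ^+ q + y ^+ q.
  by apply: exprDn_pchar; rewrite (eq_pnat _ (pcharf_eq pL)) qE pnatX pnat_id.
have q0 : q%:R = 0 :> L by rewrite qE natrX (pcharf0 pL) expr0n (gtn_eqF m_gt0).
have lamF : lam \in Fq L q.
  suff /(Fq_unitP q_gt1)[] : lam ^+ q.-1 == 1 by [].
  by rewrite -(prim_order_dvd lam_r).
have delta0 : delta != 0.
  by apply: contraNneq lam0 => d0; rewrite -delta_lam d0 expr0n.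
have delta_Fq i : delta ^+ i \in Fq L q -> (n %| i)%N.
  exact: delta_power_Fq deltaP.
have lamq k : lam ^+ (q.-1 * k) = 1.
  have /(Fq_unitP q_gt1)/eqP : lam != 0 /\ lam \in Fq L q by [].
  by rewrite exprM => ->; rewrite expr1n.
(* Since [delta ^+ n = lam] and [lam ^+ q.-1 = 1], exponents of [delta] count modulo [n * (q - 1)]:
   there [q ^ 2 - q + 1] is [q ^ 3], and [q ^ 4 - q ^ 3 + q ^ 2] is [q]. *)
have hE : g1 * g2 = \prod_(z <- conjugates q delta) ('X - z%:P).
  have qE' : (q = q.-1.+1)%N by lia.
  rewrite !big_cons big_nil mulr1 /g1 /g2 -!mulrA; congr (_ * _).
  rewrite fr2E; congr (_ * (('X - _%:P) * ('X - _%:P))).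
    have e : (q ^ 2 * q = (q ^ 2 - q + 1) + n * (q.-1 * 1))%N by rewrite /n -mulnn; nia.
    by rewrite /fr -exprM e [in RHS]exprD [in RHS]exprM delta_lam lamq mulr1.
  have e : (q ^ 4 - q ^ 3 + q ^ 2 = q + n * (q.-1 * q))%N by rewrite /n !expnS expn0; nia.
  by rewrite e exprD exprM delta_lam lamq mulr1.
have CqE : Cq = [set trace_word q delta a | a in L].
  rewrite /Cq /C hE.
  exact: (trace_codeE q_gt1 cardL frD q_gt2 q0 lamF delta_lam delta0 delta_Fq).
have t_inj : injective (trace_word q delta).
  exact: (trace_word_inj q_gt1 cardL q_gt2 q0 lamF delta_lam delta0 delta_Fq).
have wtE i : wt_count Cq i = #|[set a | hweight (trace_word q delta a) == i]|.
  rewrite /wt_count CqE -[RHS](card_imset _ t_inj); apply: eq_card => c.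
  rewrite inE; apply/andP/imsetP => [[/imsetP[a _ ->] ca]|[a]].
    by exists a => //; rewrite inE.
  by rewrite inE => ca ->; rewrite imset_f.
have w_pos : (0 < q ^ 2 - q < q ^ 2)%N by rewrite -mulnn; nia.
have wtC := card_trace_word_weight q_gt1 cardL frD q_gt2 lamF delta_lam delta0 delta_Fq.
split.
- by rewrite CqE (card_imset _ t_inj).
- split=> [|c]; rewrite CqE.
    have : (0 < #|[set a | hweight (trace_word q delta a) == (q ^ 2 - q)%N]|)%N.
      by rewrite wtC eqxx; case: ifP => // _; nia.
    case/card_gt0P => a; rewrite inE => aw; exists (trace_word q delta a).
      exact: imset_f.
    rewrite aw andbT; apply: contraTneq aw => ->.
    by rewrite hweight0; lia.
  case/imsetP => a _ ->; have [->|a0 _] := eqVneq a 0.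
    by rewrite trace_word0 ?eqxx.
  have -> := trace_word_weights q_gt1 cardL frD q_gt2 lamF delta_lam delta0 delta_Fq a0.
  by case: ifP => _; lia.
- by move=> i; rewrite wtE wtC.
- rewrite CqE dual_trace_codeE //.
  exact: (card_dual_trace_code q_gt1 cardL frD q_gt2 lamF delta_lam delta0 delta_Fq).
rewrite CqE dual_trace_codeE //; split=> [|y].
  have [y [yF sy y0 yw]] :=
    syndrome_weight4 q_gt1 cardL frD q_gt2 lamF delta_lam delta0 delta_Fq.
  exists y; last by rewrite y0 yw.
  by rewrite inE sy eqxx andbT; apply/words_onP; split=> // i _; rewrite inE.
rewrite inE => /andP[/words_onP[yF _] /eqP sy].
exact: (syndrome_weight q_gt1 cardL frD q_gt2 lamF delta_lam delta0 delta_Fq yF sy).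
Qed.
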